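(* Assume Baumgartner's Axiom $\mathsf{BA}$. Then there is a Hagendorf order of size $\aleph_1$.
   Context: Work in ZFC. A set $A\subseteq\mathbb{R}$ is $\aleph_1$-dense if its intersection with every non-empty open subset of $\mathbb{R}$ has cardinality $\aleph_1$. Baumgartner's Axiom ($\mathsf{BA}$) is the statement that any two $\aleph_1$-dense suborders of $(\mathbb{R},<)$ are isomorphic. For linear orders or order types, $\varphi\le\psi$ means $\varphi$ embeds into $\psi$ by a strictly order-preserving map, and $\varphi<\psi$ means $\varphi\le\psi$ and $\psi\not\le\varphi$. The sum $\varphi+\psi$ places a copy of $\psi$ after a copy of $\varphi$. A type $\tau$ is strictly indecomposable to the right if whenever $\tau=\varphi+\psi$ with $\psi>0$ (i.e. $\psi$ non-empty), then $\varphi<\tau$ and $\tau\le\psi$. An order type $\varphi$ is Hagendorf if (1) $\varphi$ is strictly indecomposable to the right, (2) for every order type $\psi$, $\psi<\varphi$ implies $\psi+1\le\varphi$, and (3) $\varphi$ is not the type of an ordinal. A linear order is a Hagendorf order if its type is Hagendorf. *)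

(* Defs.v *)
From HB Require Import structures.
From mathcomp Require Import all_boot all_order all_algebra.
From mathcomp Require wochoice.
From mathcomp Require Import all_classical all_reals topology normedtype.

Set Implicit Arguments.
Unset Strict Implicit.
Unset Printing Implicit Defensive.

Import Order.TTheory.
Import numFieldNormedType.Exports.

Local Open Scope classical_set_scope.
Local Open Scope card_scope.
Local Open Scope order_scope.

(* The ordered sum of two linear orders, carried by the disjoint union, with
   every element of T1 below every element of T2. *)
Definition osum (T1 T2 : Type) : Type := (T1 + T2)%type.

Fact osum_display (d1 d2 : Order.disp_t) : Order.disp_t.
Proof. exact: Order.Disp tt tt. Qed.

HB.instance Definition _ (T1 T2 : choiceType) :=
  Choice.copy (osum T1 T2) (T1 + T2)%type.

Section OsumOrder.
Variables (d1 d2 : Order.disp_t) (T1 : orderType d1) (T2 : orderType d2).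

Definition osum_le (x y : osum T1 T2) : bool :=
  match x, y with
  | inl a, inl b => a <= b
  | inr a, inr b => a <= b
  | inl _, inr _ => true
  | inr _, inl _ => false
  end.

Fact osum_le_refl : reflexive osum_le.
Proof. by case=> a /=. Qed.

Fact osum_le_anti : antisymmetric osum_le.
Proof. by case=> a [] b //= /le_anti ->. Qed.

Fact osum_le_trans : transitive osum_le.
Proof. by case=> a [] b [] c //=; apply: le_trans. Qed.

Fact osum_le_total : total osum_le.
Proof. by case=> a [] b //=; apply: le_total. Qed.

HB.instance Definition _ :=
  Order.Le_isPOrder.Build (osum_display d1 d2) (osum T1 T2)
    osum_le_refl osum_le_anti osum_le_trans.

HB.instance Definition _ :=
  Order.POrder_isTotal.Build (osum_display d1 d2) (osum T1 T2) osum_le_total.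

End OsumOrder.

Section OrderTypes.
Variables (d1 d2 : Order.disp_t) (T1 : orderType d1) (T2 : orderType d2).

Definition embeds : Prop := exists f : T1 -> T2, {homo f : x y / x < y}.

Definition order_iso : Prop :=
  exists2 f : T1 -> T2, bijective f & {mono f : x y / x <= y}.

End OrderTypes.

Arguments embeds {d1 d2} T1 T2.
Arguments order_iso {d1 d2} T1 T2.

Definition strictly_embeds (d1 d2 : Order.disp_t)
    (T1 : orderType d1) (T2 : orderType d2) : Prop :=
  embeds T1 T2 /\ ~ embeds T2 T1.

Arguments strictly_embeds {d1 d2} T1 T2.

Definition well_ordered (d : Order.disp_t) (T : orderType d) : Prop :=
  wochoice.well_order (<=%O : rel T).

Arguments well_ordered {d} T.

Definition strictly_indecomposable_right
    (d : Order.disp_t) (T : orderType d) : Prop :=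
  forall (d1 d2 : Order.disp_t) (P : orderType d1) (Q : orderType d2),
    order_iso T (osum P Q) -> inhabited Q ->
    strictly_embeds P T /\ embeds T Q.

Arguments strictly_indecomposable_right {d} T.

(* An order type is the type of an ordinal iff it is a well-order. *)
Definition hagendorf (d : Order.disp_t) (T : orderType d) : Prop :=
  [/\ strictly_indecomposable_right T,
      forall (d' : Order.disp_t) (S : orderType d'),
        strictly_embeds S T -> embeds (osum S 'I_1) T
    & ~ well_ordered T].

Arguments hagendorf {d} T.

(* W has the order type of the first uncountable ordinal: it is an uncountable
   well-order all of whose proper initial segments are countable. *)
Definition omega1_type (d : Order.disp_t) (W : orderType d) : Prop :=
  [/\ well_ordered W,
      ~ countable [set: W]
    & forall x : W, countable [set y : W | y < x]].

Arguments omega1_type {d} W.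

Definition card_aleph1 (T : Type) (A : set T) : Prop :=
  exists (d : Order.disp_t) (W : orderType d),
    omega1_type W /\ A #= [set: W].

Definition aleph1_dense (R : realType) (A : set R) : Prop :=
  forall U : set R, open U -> U !=set0 -> card_aleph1 (A `&` U).

Definition baumgartner_axiom (R : realType) : Prop :=
  forall A B : set R, aleph1_dense A -> aleph1_dense B ->
    exists2 f : R -> R, set_bij A B f & {in A &, {mono f : x y / x <= y}}.

(* Main.v *)
Require Import Defs.
From mathcomp Require Import all_boot all_order all_classical all_reals.
From HB Require Import structures.
From mathcomp Require Import all_algebra.
From mathcomp Require wochoice.
From mathcomp Require Import topology normedtype.
From mathcomp Require lebesgue_measure.
From mathcomp Require Import lra.

(** The example is the sum [1 + A + A^2 + A^3 + ...], where [A] is an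
    aleph_1-dense set of reals and [A^n] is its [n]-th lexicographic power.  It
    is realized as the finite sequences of elements of [A], ordered first by
    length and then lexicographically ([word_order]).

    Baumgartner's Axiom makes all uncountable sets of reals of size aleph_1
    equivalent under embeddability.  Every set [X] of reals of size at most
    aleph_1 embeds in [A], because [X] together with [A] is again aleph_1-dense
    ([small_embeds]).  Conversely, if [X] is uncountable then [A] embeds in it
    ([embeds_uncountable]): squeezing out the countable convex pieces of [X]
    maps a subset of [X] onto an aleph_1-dense set.

    Two facts on the powers follow.
    - [A^(n+1)] does not embed in [A^n] ([words_not_emb]).  Under such an
      embedding, the first coordinates of the images of the uncountably many
      consecutive copies of [A^n] span intervals that overlap only at
      endpoints.  So one of these intervals is a single point, and dropping
      that coordinate embeds [A^n] in [A^(n-1)].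
    - If [X] is contained in some power of [A] and [A^k] does not embed in
      [X], then [X] embeds in [A^k], with a [k] that does not depend on the
      power containing [X] ([words_dichotomy]).

    The Hagendorf properties are consequences.  A proper initial segment of the
    sum is bounded in length, so the whole cannot embed in it, while prefixing
    a long constant word embeds the whole in any nonempty final segment.  Now
    let [S] be a suborder with levels [X n] included in [A^n].  If for every
    [k] the power [A^k] embeds in [X n] for arbitrarily large [n], the whole
    sum embeds in [S].  Otherwise some [A^k] embeds in no [X n] with [n]
    large; then all these levels embed in [A^k], so they fit together in
    [A^(k+1)], side by side over an increasing sequence of first coordinates.
    Hence [S] embeds in a bounded part and leaves room for one more point. *)

Set Implicit Arguments.
Unset Strict Implicit.
Unset Printing Implicit Defensive.

Import Order.TTheory GRing.Theory Num.Theory.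
Import numFieldNormedType.Exports.

Local Open Scope classical_set_scope.
Local Open Scope card_scope.
Local Open Scope order_scope.

(** * Countability and cardinality aleph_1 *)

Fact rel_display : Order.disp_t. Proof. exact: Order.Disp tt tt. Qed.

Section RelOrder.
Variables (T : choiceType) (r : rel T).
Hypotheses (ra : antisymmetric r) (rt : transitive r) (rtot : total r).

(** The proofs are parameters of the alias so that the order structure can be
    found from the type alone. *)
Definition rel_order of antisymmetric r & transitive r & total r : Type := T.
Local Notation U := (rel_order ra rt rtot).

HB.instance Definition _ := Choice.copy U T.
Fact rel_order_refl : reflexive r.
Proof. by move=> x; have := rtot x x; rewrite orbb. Qed.
HB.instance Definition _ :=
  Order.Le_isPOrder.Build rel_display U rel_order_refl ra rt.
HB.instance Definition _ := Order.POrder_isTotal.Build rel_display U rtot.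
End RelOrder.

Lemma countableS T (A B : set T) : A `<=` B -> countable B -> countable A.
Proof. by move=> AB; apply: sub_countable; apply: subset_card_le. Qed.

Lemma countable_image T U (f : T -> U) (A : set T) :
  countable A -> countable (f @` A).
Proof. by apply: sub_countable; apply: card_image_le. Qed.

Lemma countable_inj T U (f : T -> U) (A : set T) (B : set U) :
  (forall x, A x -> B (f x)) -> {in A &, injective f} ->
  countable B -> countable A.
Proof.
move=> fAB finj /countable_injP[g ginj]; apply/countable_injP.
exists (g \o f) => x y Ax Ay /= /ginj e; apply: finj => //.
by apply: e; rewrite inE; apply: fAB; rewrite -inE.
Qed.

Lemma countable_cover I T (D : set I) (F : I -> set T) (A : set T) :
  (forall x, A x -> exists2 i, D i & F i x) ->
  countable D -> (forall i, D i -> countable (F i)) -> countable A.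
Proof.
move=> cov cD cF; apply: countableS (bigcup_countable cD cF) => x /cov[i Di Fi].
by exists i.
Qed.

Lemma countable_setU T (A B : set T) :
  countable A -> countable B -> countable (A `|` B).
Proof.
move=> cA cB.
apply: (@countable_cover bool _ setT (fun b => if b then A else B)) => //.
- by move=> x [Ax|Bx]; [exists true|exists false].
- by case.
Qed.

Lemma uncountableD T (A B : set T) :
  ~ countable A -> countable B -> ~ countable (A `\` B).
Proof.
move=> uA cB cAB; apply: uA; apply: countableS (countable_setU cAB cB) => x Ax.
by have [Bx|nBx] := pselect (B x); [right|left].
Qed.

Lemma uncountable_ex T (A : set T) : ~ countable A -> exists x, A x.
Proof.
move=> uA; apply: contrapT => nA; apply: uA.
suff -> : A = set0 by apply: countable0.
by apply/seteqP; split=> x // Ax; apply: nA; exists x.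
Qed.

Lemma well_ordered_min d (W : orderType d) (A : set W) :
  well_ordered W -> A !=set0 -> exists2 x, A x & forall y, A y -> x <= y.
Proof.
move=> wo [x Ax]; have [|z [[Az lz] _]] := wo (mem A).
  by exists x; rewrite inE.
exists z; first by move: Az; rewrite inE.
by move=> y Ay; apply: lz; rewrite inE.
Qed.

Lemma well_ordered_of_min d (W : orderType d) :
  (forall A : set W, A !=set0 -> exists2 x, A x & forall y, A y -> x <= y) ->
  well_ordered W.
Proof.
move=> H; apply: wochoice.antisymmetric_well_order.
  by move=> x y; apply: le_anti.
move=> A [x Ax]; have [|z Az lz] := H [set x | x \in A]; first by exists x.
by exists z; split.
Qed.

(** For [W] of type omega_1 this says that [X] has cardinality at most aleph_1.
    Asking for countable fibers instead of an injection makes the closure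
    properties below immediate, with no appeal to [aleph_1 * aleph_0 = aleph_1].
    *)
Definition small d (W : orderType d) T (X : set T) :=
  exists f : T -> W, forall w, countable (X `&` [set x | f x = w]).
Arguments small {d} W {T} X.

Section Small.
Variables (d : Order.disp_t) (W : orderType d).
Hypothesis woW : well_ordered W.
Hypothesis initW : forall x : W, countable [set y : W | y < x].

Lemma small_sub T (X Y : set T) : X `<=` Y -> small W Y -> small W X.
Proof.
by move=> XY [f fc]; exists f => w; apply: countableS (fc w) => x [/XY].
Qed.

Lemma small_image T U (w0 : W) (g : T -> U) (X : set T) :
  small W X -> small W (g @` X).
Proof.
move=> [f fc].
pose h u := if pselect (exists2 x, X x & g x = u) is left e
            then f (projT1 (cid2 e)) else w0.
exists h => w; apply: countableS (countable_image g (fc w)) => u [gXu /=].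
rewrite /h; case: pselect => // e; case: (cid2 e) => x Xx gx /= fx.
by exists x.
Qed.

Lemma small_setU T (X Y : set T) : small W X -> small W Y -> small W (X `|` Y).
Proof.
move=> [f fc] [g gc]; exists (fun x => if `[< X x >] then f x else g x) => w.
apply: countableS (countable_setU (fc w) (gc w)) => x [XY /=].
by case: asboolP XY => [Xx _ <-|nX [//|Yx] <-]; [left|right].
Qed.

Lemma countable_small T (w0 : W) (X : set T) : countable X -> small W X.
Proof. by move=> cX; exists (fun=> w0) => w; apply: countableS cX => x []. Qed.

(** Send a word to the largest value of its letters: a fiber consists of words
    over a countable alphabet. *)
Lemma small_seq (T : eqType) (w0 : W) (X : set T) :
  small W X -> small W [set s : seq T | forall x, x \in s -> X x].
Proof.
move=> [f fc].
pose m := fix m (s : seq T) := if s is x :: s' then Order.max (f x) (m s') else w0.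
have mP s x : x \in s -> f x <= m s.
  elim: s => //= y s IH; rewrite in_cons le_max => /orP[/eqP->|/IH->].
    by rewrite lexx.
  by rewrite orbT.
exists m => w; pose Y := [set x | X x /\ f x <= w].
have cY : countable Y.
  apply: (@countable_cover W _ [set v | v < w \/ v = w]
            (fun v => X `&` [set x | f x = v])); last by move=> v _; apply: fc.
  - move=> x [Xx fx]; exists (f x) => //=.
    by move: fx; rewrite le_eqVlt => /orP[/eqP|]; [right|left].
  - by apply: countable_setU; [apply: initW|apply: countable1].
have /countable_injP[c cinj] := cY.
apply/countable_injP; exists (fun s => pickle (map c s)).
have aux : forall s t : seq T, (forall x, x \in s -> Y x) ->
    (forall x, x \in t -> Y x) -> map c s = map c t -> s = t.
  elim=> [|x s IH] [|y t] //= hs ht [/cinj exy /IH est].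
  have eq_xy : x = y.
    by apply: exy; rewrite inE; [apply: hs|apply: ht]; rewrite mem_head.
  by rewrite eq_xy est // => z zi; [apply: hs|apply: ht]; rewrite in_cons zi orbT.
have inY s : s \in [set s : seq T | forall x, x \in s -> X x] `&`
   [set x | m x = w] -> forall x, x \in s -> Y x.
  by rewrite inE => -[/= sX ms] x xs; split; [apply: sX|rewrite -ms; apply: mP].
by move=> s t /inY sY /inY tY /(pcan_inj pickleK) /aux; apply.
Qed.

(** Refine the preorder given by [f : T -> W] by enumerating each countable
    fiber.  The result is a well-order of [X] with countable proper initial segments,
    so it has type omega_1 as soon as [X] is uncountable. *)
Lemma small_card_aleph1 (T : choiceType) (X : set T) :
  small W X -> ~ countable X -> card_aleph1 X.
Proof.
move=> [f fc] uX.
pose U : choiceType := {x : T | x \in X}.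
have /choice[c cP] w : exists c : T -> nat,
    {in X `&` [set x | f x = w] &, injective c}.
  by apply/countable_injP; apply: fc.
pose g (u : U) := f (val u); pose k (u : U) := c (g u) (val u).
have gk_inj u v : g u = g v -> k u = k v -> u = v.
  rewrite /k => guv; rewrite -guv => /cP e; apply/val_inj/e; rewrite inE; split.
  - by have := valP u; rewrite inE.
  - by [].
  - by have := valP v; rewrite inE.
  - by rewrite /= -/(g v) -guv.
pose r : rel U := fun u v => (g u < g v) || (g u == g v) && (k u <= k v)%N.
have ra : antisymmetric r.
  move=> u v; rewrite /r; case: (ltgtP (g u) (g v)) => //= guv /anti_leq kuv.
  exact: gk_inj.
have rt : transitive r.
  move=> v u w; rewrite /r => /orP[h1|/andP[/eqP-> h1]] /orP[h2|/andP[/eqP<- h2]].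
  - by rewrite (lt_trans h1 h2).
  - by rewrite h1.
  - by rewrite h2.
  - by rewrite eqxx (leq_trans h1 h2) orbT.
have rtot : total r.
  by move=> u v; rewrite /r; case: (ltgtP (g u) (g v)) => //= _; apply: leq_total.
exists rel_display, (rel_order ra rt rtot); split; last first.
  have -> : X = val @` [set: U].
    apply/seteqP; split=> [x Xx|_ [u _ <-]].
    - by have Xx' : x \in X; [rewrite inE|exists (exist _ x Xx')].
    - by have := valP u; rewrite inE.
  by apply: (@inj_card_eq U T setT val) => x y _ _ /val_inj.
split.
- apply: well_ordered_of_min => A A0.
  have gA0 : (g @` A) !=set0 by case: A0 => a Aa; exists (g a), a.
  have [w [a Aa ga] wmin] := well_ordered_min woW gA0.
  have ex : exists n, `[< exists2 u, A u & g u = w /\ k u = n >].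
    by exists (k a); apply/asboolP; exists a.
  case: (ex_minnP ex) => n /asboolP[u Au [gu ku]] nmin; exists u => // v Av.
  rewrite /Order.le /= /r; have : w <= g v by apply: wmin; exists v.
  rewrite le_eqVlt -gu => /orP[/eqP e|->//]; rewrite e eqxx /=.
  by rewrite ku nmin ?orbT //; apply/asboolP; exists v => //; rewrite -e.
- move=> cU; apply: uX.
  have -> : X = val @` [set: U].
    apply/seteqP; split=> [x Xx|_ [u _ <-]].
    - by have Xx' : x \in X; [rewrite inE|exists (exist _ x Xx')].
    - by have := valP u; rewrite inE.
  exact: countable_image.
- move=> u.
  apply: (@countable_cover W _ [set w | w < g u \/ w = g u]
            (fun w => [set v : U | g v = w])).
  + move=> v /= vu; exists (g v) => //=; have : r v u by apply: (ltW vu).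
    by case/orP => [|/andP[/eqP]]; [left|right].
  + by apply: countable_setU; [apply: initW|apply: countable1].
  + move=> w _; apply: (countable_inj (f := val) (B := X `&` [set x | f x = w])).
    * by move=> v /= gv; split=> //; have := valP v; rewrite inE.
    * by move=> ? ? _ _ /val_inj.
    * exact: fc.
Qed.

End Small.

Local Open Scope ring_scope.

(** * Aleph_1-dense sets of reals *)

Lemma real_uncountable (R : realType) : ~ countable [set: R].
Proof.
move=> cR.
have := lebesgue_measure.countable_lebesgue_measure0
  (countableS (@subsetT _ `]0, 1[%classic) cR).
rewrite lebesgue_measure.lebesgue_measure_itv /= lte_fin ltr01 oppr0 adde0.
by move=> /eqP; rewrite eqe oner_eq0.
Qed.

(** Take the points of a well-order of the reals whose initial segments are
    countable.  Were there only countably many of them, the least point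
    outside would have a countable initial segment, hence be one of them. *)
Lemma omega1_in_reals (R : realType) :
  exists (d : Order.disp_t) (W : orderType d) (v : W -> R),
    [/\ injective v, well_ordered W, forall x : W, countable [set y : W | (y < x)%O]
      & ~ countable [set: W]].
Proof.
have [r wo] := wochoice.well_ordering_principle R.
have mem2 (x y : R) : wochoice.nonempty [pred z | (z == x) || (z == y)].
  by exists x; rewrite inE eqxx.
have rtot : total r.
  move=> x y; have [z [[+ lz] _]] := wo _ (mem2 x y); rewrite inE => /orP[] /eqP zE.
  - by rewrite -zE lz ?inE ?eqxx ?orbT.
  - by rewrite -[X in r X x]zE lz ?inE ?eqxx ?orbT.
have rr x : r x x by have := rtot x x; rewrite orbb.
have ra : antisymmetric r.
  move=> x y /andP[xy yx]; have [z [_ uz]] := wo _ (mem2 x y).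
  rewrite -(uz x) ?(uz y) //; split; rewrite ?inE ?eqxx ?orbT //.
  - by move=> t; rewrite inE => /orP[]/eqP->.
  - by move=> t; rewrite inE => /orP[]/eqP->.
have rt : transitive r.
  move=> y x z xy yz.
  have [|t [[+ lt] _]] := wo [pred t | [|| t == x, t == y | t == z]].
    by exists x; rewrite inE eqxx.
  rewrite inE => /or3P[] /eqP tE.
  - by rewrite -tE lt ?inE ?eqxx ?orbT.
  - have yx : r y x by rewrite -tE lt ?inE ?eqxx.
    by have -> : x = y by apply: ra; rewrite xy yx.
  - have zy : r z y by rewrite -tE lt ?inE ?eqxx ?orbT.
    by have -> : z = y by apply: ra; rewrite zy yz.
pose V : orderType _ := rel_order ra rt rtot.
pose W : orderType _ := sub_type {x : V | `[< countable [set y : V | (y < x)%O] >]}.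
have leE (x y : W) : (x <= y)%O = r (val x) (val y) by [].
have woW : well_ordered W.
  apply: well_ordered_of_min => A [a Aa].
  have [|z [[zA lz] _]] := wo [pred x | `[< exists2 u, A u & val u = x :> R >]].
    by exists (val a); rewrite inE; exists a.
  move: zA; rewrite inE => -[u Au uz]; exists u => // y Ay.
  by rewrite leE uz lz // inE; exists y.
exists _, W, (fun x => val x : R); split => //.
- move=> x; apply: (countable_inj (f := val) (B := [set y : V | (y < val x)%O])) => //.
  + by move=> ? ? _ _ /val_inj.
  + by have /asboolP := valP x.
- move=> cW; apply: (@real_uncountable R).
  have cI : countable ((fun x : W => val x : R) @` setT) by apply: countable_image.
  have [all|/existsNP[b nb]] := pselect (forall x : V, countable [set y : V | (y < x)%O]).
    apply: countableS cI => x _.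
    have Px : `[< countable [set y : V | (y < (x : V))%O] >] by apply/asboolP.
    by exists (exist _ (x : V) Px).
  exfalso.
  have [|z [[+ lz] _]] := wo [pred x | `[< ~ countable [set y : V | (y < (x : V))%O] >]].
    by exists b; rewrite inE.
  rewrite inE; apply.
  apply: countableS cI => y /= yz.
  have Py : `[< countable [set t : V | (t < y)%O] >].
    apply/asboolP; apply: contrapT => ncy.
    have zy : r z y by apply: lz; rewrite inE.
    by move: yz; rewrite ltNge => /negP; apply; exact: zy.
  by exists (exist _ y Py).
Qed.

Lemma open_interval (R : realType) (U : set R) :
  open U -> U !=set0 -> exists p q, p < q /\ forall x, p < x < q -> U x.
Proof.
move=> oU [x Ux].
have [e /= e0 eU] : nbhs_ball x U by apply/nbhs_ballP; apply: open_nbhs_nbhs.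
exists (x - e), (x + e); split; first by lra.
by move=> y xy; apply: eU; rewrite /ball /= ltr_norml; lra.
Qed.

Section Dense.
Variables (R : realType) (d : Order.disp_t) (W : orderType d).
Hypothesis woW : well_ordered W.
Hypothesis initW : forall x : W, countable [set y : W | (y < x)%O].

Definition small_dense (A : set R) :=
  small W A /\ forall p q, p < q -> ~ countable (A `&` [set x | p < x < q]).

Lemma small_dense_aleph1_dense A : small_dense A -> aleph1_dense A.
Proof.
move=> [sA dA] U oU U0; apply: (small_card_aleph1 woW initW).
  by apply: small_sub sA => x [].
have [p [q [pq pqU]]] := open_interval oU U0 => cAU.
by apply: (dA p q pq); apply: countableS cAU => x [Ax /pqU].
Qed.

Lemma small_denseU A X : small_dense A -> small W X -> small_dense (A `|` X).
Proof.
move=> [sA dA] sX; split; first exact: small_setU.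
move=> p q pq cAX; apply: (dA p q pq); apply: countableS cAX => x [Ax xpq].
by split=> //; left.
Qed.

(** Take all rational translates of a set of reals of size aleph_1: each of its
    points has a translate in any given interval, and a real is a translate of
    only countably many points. *)
Lemma small_dense_exists (v : W -> R) :
  injective v -> ~ countable [set: W] -> exists A, small_dense A.
Proof.
move=> vinj uW; exists [set x | exists w (q : rat), x = v w + ratr q]; split.
  have [w0 _] := uncountable_ex uW.
  pose f x := xget w0 [set w | exists q : rat, x = v w + ratr q].
  exists f => w.
  apply: (@countableS _ _ ((fun q : rat => v w + ratr q) @` setT)).
    move=> x [[w' [q xE]] /= fx].
    have [q' ->] : exists q' : rat, x = v w + ratr q'.
      rewrite -fx.
      by apply: (@xgetI _ w0 [set w | exists q, x = v w + ratr q] w'); exists q.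
    by exists q'.
  exact: countable_image.
move=> p q pq cA; apply: uW.
apply: (@countable_cover (R * rat) _
  (setX ([set x | exists w q, x = v w + ratr q] `&` [set x | p < x < q]) setT)
  (fun xq => [set w | v w = xq.1 - ratr xq.2])).
- move=> w _; have [q' q'I] : exists q' : rat, ratr q' \in `]p - v w, q - v w[%R.
    by apply: rat_in_itvoo; lra.
  exists (v w + ratr q', q') => /=; last by rewrite addrK.
  split=> //=; split; first by exists w, q'.
  by move: q'I; rewrite in_itv /=; lra.
- exact: countableX.
- move=> [x q'] _ /=; apply: (countable_inj (f := v) (B := [set x - ratr q'])) => //.
  + by move=> ? ? _ _ /vinj.
Qed.

Hypothesis hBA : baumgartner_axiom R.

(** [A] together with [X] is again aleph_1-dense, hence isomorphic to [A]. *)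
Lemma small_embeds A X : small_dense A -> small W X ->
  exists g : R -> R, (forall x, X x -> A (g x)) /\
    (forall x y, X x -> X y -> x < y -> g x < g y).
Proof.
move=> dA sX; have dAX := small_denseU dA sX.
have [g [gA _ _] gm] := hBA (small_dense_aleph1_dense dAX)
                            (small_dense_aleph1_dense dA).
exists g; split=> [x Xx|x y Xx Xy xy]; first by apply: gA; right.
by rewrite (leW_mono_in gm) // inE; right.
Qed.

End Dense.

(** * Collapsing an uncountable set of reals onto a dense one *)

Lemma rat_between (R : realType) (x y : R) :
  x < y -> exists q : rat, x < ratr q < y.
Proof. by move=> /rat_in_itvoo[q]; rewrite in_itv; exists q. Qed.

(** Removing the points [x] with [X] countable on some interval to the right of
    [x] costs only countably many points.  Indeed, for a fixed rational right
    end [q], each such point except the leftmost has a rational [p] on its left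
    with [X] countable on [(p, q)]. *)
Lemma right_condensation (R : realType) (X : set R) : ~ countable X ->
  exists Y, [/\ Y `<=` X, ~ countable Y &
    forall x y, Y x -> x < y -> ~ countable (Y `&` [set z | x < z < y])].
Proof.
move=> uX; pose E := [set x | X x /\
  exists2 y, x < y & countable (X `&` [set z | x < z < y])].
pose Eq q := [set x | [/\ X x, x < q & countable (X `&` [set z | x < z < q])]].
have cE : countable E.
  apply: (@countable_cover (rat * rat) _ setT (fun pq =>
    [set x | Eq (ratr pq.2) x /\ forall x', Eq (ratr pq.2) x' -> x <= x'] `|`
    [set x | countable (X `&` [set z | ratr pq.1 < z < ratr pq.2]) /\
             (X `&` [set z | ratr pq.1 < z < ratr pq.2]) x])).
  - move=> x [Xx [y xy cxy]]; have [q /andP[xq qy]] := rat_between xy.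
    have Ex : Eq (ratr q) x.
      split=> //; apply: countableS cxy => z [Xz /= /andP[xz zq]].
      by split=> //=; rewrite xz (lt_trans zq).
    have [xmin|] := pselect (forall x', Eq (ratr q) x' -> x <= x').
      by exists (0, q) => //; left.
    move=> /existsNP[x' /not_implyP[[Xx' x'q cx'] /negP]].
    rewrite -ltNge => /rat_between[p /andP[x'p px]].
    exists (p, q) => //; right => /=; split; last by split=> //=; rewrite px xq.
    apply: countableS cx' => z [Xz /= /andP[pz zq]].
    by split=> //=; rewrite zq (lt_trans x'p).
  - exact: countableP.
  - move=> [p q] _ /=; apply: countable_setU.
      have [[x [Ex xmin]]|no] := pselect (exists x, Eq (ratr q) x /\
          forall x', Eq (ratr q) x' -> x <= x').
        apply: (@countableS _ _ [set x]); last exact: countable1.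
        by move=> y [Ey ymin]; apply/le_anti; rewrite xmin // ymin.
      by apply: countableS (@countable0 R) => x xmin; apply: no; exists x.
    have [c|nc] := pselect (countable (X `&` [set z | ratr p < z < ratr q])).
      by apply: countableS c => x [].
    by apply: countableS (@countable0 R) => x [].
exists (X `\` E); split; first by move=> x [].
- exact: uncountableD.
- move=> x y [Xx nEx] xy cY; apply: nEx; split=> //; exists y => //.
  apply: countableS (countable_setU cY cE) => z [Xz xzy].
  by have [Ez|nEz] := pselect (E z); [right|left; split].
Qed.

(** Points of [Y] are placed at the dyadic fractions of [0, 1], with [dyad n k]
    at [k / 2 ^ n], by repeated bisection: an interval is always bisected at
    the point [d i] of least index inside it.  That choice guarantees that the
    placed points separate the points of [Y] ([dyad_sep]). *)
Section Dyadic.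
Variables (R : realType) (Y : set R) (d : nat -> R) (x0 x1 : R).
Hypothesis Yd : forall n, Y (d n).
Hypothesis dsep : forall x y, Y x -> x < y -> exists n, x < d n < y.
Hypotheses (Yx0 : Y x0) (Yx1 : Y x1) (x01 : x0 < x1).

Definition mid x y :=
  if pselect (exists n, x < d n < y) is left e then d (ex_minn e) else x.

Lemma midP x y : Y x -> x < y ->
  exists i, [/\ mid x y = d i, x < d i < y &
                forall j, x < d j < y -> (i <= j)%N].
Proof.
move=> Yx xy; rewrite /mid; case: pselect => [e|]; last by case; apply: dsep.
by case: ex_minnP => i Pi imin; exists i.
Qed.

Fixpoint dyad n k :=
  if n is n'.+1 then
    if odd k then mid (dyad n' k./2) (dyad n' k./2.+1) else dyad n' k./2
  else if k is 0 then x0 else x1.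

Lemma dyad_even n k : dyad n.+1 k.*2 = dyad n k.
Proof. by rewrite /= odd_double doubleK. Qed.

Lemma dyad_odd n k : dyad n.+1 k.*2.+1 = mid (dyad n k) (dyad n k.+1).
Proof. by rewrite /= odd_double /= uphalf_double. Qed.

Lemma halfP k : exists h, k = h.*2 \/ k = h.*2.+1.
Proof.
exists k./2; rewrite -{1 3}[k]odd_double_half.
by case: (odd k); [right|left].
Qed.

Lemma dyad_step n k : (k < 2 ^ n)%N ->
  [/\ Y (dyad n k), Y (dyad n k.+1) & dyad n k < dyad n k.+1].
Proof.
elim: n k => [|n IH] k; first by case: k.
rewrite expnS mul2n => kn; have [h [] kh] := halfP k; rewrite {}kh in kn *.
- have /IH[Yh Yh' hh'] : (h < 2 ^ n)%N by rewrite -ltn_double.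
  have [i [mE /andP[hi _] _]] := midP Yh hh'.
  by rewrite dyad_even dyad_odd mE.
- have /IH[Yh Yh' hh'] : (h < 2 ^ n)%N.
    by rewrite -ltn_double (leq_trans _ kn).
  have [i [mE /andP[_ ih] _]] := midP Yh hh'.
  by rewrite dyad_odd -doubleS dyad_even mE.
Qed.

Lemma dyad_lt n k l : (k < l)%N -> (l <= 2 ^ n)%N -> dyad n k < dyad n l.
Proof.
elim: l => // l IH; rewrite ltnS leq_eqVlt => /orP[/eqP->|kl] ln.
  by have [] := dyad_step ln.
by apply: lt_trans (IH kl (ltnW ln)) _; have [] := dyad_step ln.
Qed.

Lemma dyad_le n k l : (k <= l)%N -> (l <= 2 ^ n)%N -> dyad n k <= dyad n l.
Proof.
by rewrite leq_eqVlt => /orP[/eqP->//|kl ln]; apply/ltW/dyad_lt.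
Qed.

Lemma dyad_refine m n k : dyad (m + n) (2 ^ m * k) = dyad n k.
Proof.
elim: m => [|m IH]; first by rewrite mul1n.
by rewrite expnS -mulnA mul2n addSn dyad_even.
Qed.

Definition frac n k : R := k%:R / 2 ^+ n.

Lemma dyad_frac_lt m n k l : (k <= 2 ^ n)%N -> (l <= 2 ^ m)%N ->
  dyad m l < dyad n k -> frac m l < frac n k.
Proof.
move=> kn lm; rewrite -(dyad_refine n m l) -(dyad_refine m n k) addnC => lt.
rewrite /frac ltr_pdivrMr ?exprn_gt0 // mulrAC ltr_pdivlMr ?exprn_gt0 //.
rewrite -!natrX -!natrM ltr_nat mulnC [X in (_ < X)%N]mulnC ltnNge.
apply/negP => kl; have ln : (2 ^ n * l <= 2 ^ (m + n))%N.
  by rewrite addnC expnD leq_pmul2l ?expn_gt0.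
by have := dyad_le kl ln; rewrite leNgt lt.
Qed.

(** The monotone map inverse to the dyadic placement.  Every dyadic fraction is a
    value, so the image is dense in [0, 1]; nevertheless the map is injective
    on the part of [Y] between [x0] and [x1]. *)
Definition collapse x := sup [set t | exists n k,
  [/\ (k <= 2 ^ n)%N, dyad n k <= x & t = frac n k]].

Lemma collapse_has_sup x : x0 <= x -> has_sup [set t | exists n k,
  [/\ (k <= 2 ^ n)%N, dyad n k <= x & t = frac n k]].
Proof.
move=> x0x; split; first by exists 0, 0%N, 0%N; rewrite /frac mul0r.
exists 1 => _ [n [k [kn _ ->]]].
by rewrite /frac ler_pdivrMr ?exprn_gt0 // mul1r -natrX ler_nat.
Qed.

Lemma collapse_ge n k x : (k <= 2 ^ n)%N -> x0 <= x ->
  dyad n k <= x -> frac n k <= collapse x.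
Proof.
move=> kn x0x nkx; apply: ub_le_sup; last by exists n, k.
by have [] := collapse_has_sup x0x.
Qed.

Lemma collapse_le n k x : (k <= 2 ^ n)%N -> x0 <= x ->
  x < dyad n k -> collapse x <= frac n k.
Proof.
move=> kn x0x xnk; apply: ge_sup; first by have [] := collapse_has_sup x0x.
move=> _ [m [l [lm mlx ->]]]; apply/ltW/dyad_frac_lt => //.
exact: le_lt_trans xnk.
Qed.

(** If [x] and [y] lay in the same dyadic interval at all levels, the least
    index found at level [n] would be at least [n], while some [d j] lies between [x]
    and [y] and bounds all these indices by [j]. *)
Lemma dyad_sep x y : Y x -> x0 <= x -> x < y -> y <= x1 ->
  exists n k, (k <= 2 ^ n)%N /\ x < dyad n k < y.
Proof.
move=> Yx x0x xy yx1; have [j xjy] := dsep Yx xy.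
apply: contrapT => none.
(* If no dyadic point separates x from y, then at each level n one dyadic
   interval contains both, and none of the first n points lies inside it. *)
suff /(_ j.+1)[k [_ kx ky kd]] : forall n, exists k,
    [/\ (k < 2 ^ n)%N, dyad n k <= x, y <= dyad n k.+1 &
      forall i, (i < n)%N -> ~~ (dyad n k < d i < dyad n k.+1)].
  have /negP[] := kd j (ltnSn j); case/andP: xjy => xj jy.
  by rewrite (le_lt_trans kx) // (lt_le_trans jy).
elim=> [|n [k [kn kx ky kd]]]; first by exists 0%N.
have [Yk Yk' kk'] := dyad_step kn.
have [i [mE /andP[ki ik'] imin]] := midP Yk kk'.
have ni : (n <= i)%N.
  by rewrite leqNgt; apply/negP => /kd; rewrite ki ik'.
have new j' : (j' < n.+1)%N -> dyad n k < d j' < dyad n k.+1 -> i = j'.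
  rewrite ltnS => j'n /[dup] h /imin ij'.
  by apply/eqP; rewrite eqn_leq ij' (leq_trans j'n).
have [im|im] := leP y (d i).
- exists k.*2; rewrite dyad_even dyad_odd mE; split=> //.
    by rewrite expnS mul2n ltn_double.
  move=> j' /new e; apply/negP => /andP[a b].
  have ij' : i = j' by apply: e; rewrite a (lt_trans b).
  by move: b; rewrite ij' ltxx.
- exists k.*2.+1; rewrite dyad_odd -doubleS dyad_even mE; split=> //.
  + by rewrite expnS mul2n leq_double.
  + rewrite leNgt; apply/negP => xi; apply: none.
    exists n.+1, k.*2.+1; rewrite dyad_odd mE xi im expnS mul2n; split=> //.
    by rewrite (leq_trans _ (_ : k.+1.*2 <= _)%N) ?leq_double // doubleS.
  + move=> j' /new e; apply/negP => /andP[a b].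
    have ij' : i = j' by apply: e; rewrite b (lt_trans ki).
    by move: a; rewrite ij' ltxx.
Qed.

(** Two dyadic points are needed strictly between [x] and [y], as a single one
    only gives a weak inequality. *)
Lemma collapse_lt x y : Y x -> x0 <= x -> x < y -> y <= x1 ->
  collapse x < collapse y.
Proof.
move=> Yx x0x xy yx1; have [n [k [kn /andP[xk ky]]]] := dyad_sep Yx x0x xy yx1.
have [m [l [lm /andP[xl lk]]]] := dyad_sep Yx x0x xk (ltW (lt_le_trans ky yx1)).
apply: le_lt_trans (collapse_le lm x0x xl) _.
apply: lt_le_trans (collapse_ge kn (ltW (le_lt_trans x0x xy)) (ltW ky)).
exact: dyad_frac_lt.
Qed.

Lemma collapse_dense p q : 0 <= p -> p < q -> q <= 1 ->
  exists a b, [/\ Y a, a < b, x0 <= a, b <= x1 &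
    forall x, a < x < b -> p < collapse x < q].
Proof.
move=> p0 pq q1.
(* With mesh 2 ^- n < (q - p) / 2 a closed dyadic interval lies in (p, q). *)
have [n nP] : exists n, 2 / (q - p) < 2 ^+ n :> R.
  pose N := Num.bound (2 / (q - p)).
  exists N; apply: lt_trans (archi_boundP _) _.
    by rewrite divr_ge0 // subr_ge0 ltW.
  by rewrite -natrX ltr_nat ltn_expl.
have e0 : 0 < 2 ^+ n :> R by rewrite exprn_gt0.
have {}nP : p * 2 ^+ n + 2 < q * 2 ^+ n.
  by move: nP; rewrite ltr_pdivrMr ?subr_gt0 //; lra.
have pn0 : 0 <= p * 2 ^+ n by rewrite mulr_ge0 // ltW.
pose k := (Num.truncn (p * 2 ^+ n)).+1.
have /andP[k1 k2] := truncn_itv pn0.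
have k3 : k%:R = (Num.truncn (p * 2 ^+ n))%:R + 1 :> R by rewrite /k -addn1 natrD.
have k4 : k.+1%:R = k%:R + 1 :> R by rewrite -addn1 natrD.
have kn : (k < 2 ^ n)%N.
  rewrite -(ltr_nat R) natrX.
  have : q * 2 ^+ n <= 2 ^+ n by rewrite ler_piMl // ltW.
  by rewrite -/k in k2; lra.
have [Yk Yk' kk'] := dyad_step kn.
have ax0 : x0 <= dyad n k.
  have -> : x0 = dyad n 0 by elim: (n) => //= ? <-.
  by apply: dyad_le => //; apply: ltnW.
have bx1 : dyad n k.+1 <= x1.
  have -> : x1 = dyad n (2 ^ n).
    by have := dyad_refine n 0 1; rewrite addn0 muln1 => ->.
  exact: dyad_le.
exists (dyad n k), (dyad n k.+1); split=> // x /andP[kx xk].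
have x0x : x0 <= x by apply: le_trans ax0 (ltW kx).
apply/andP; split.
- apply: lt_le_trans (collapse_ge (ltnW kn) x0x (ltW kx)).
  by rewrite /frac ltr_pdivlMr.
- apply: le_lt_trans (collapse_le kn x0x xk) _.
  by rewrite /frac ltr_pdivrMr //; rewrite -/k in k2; lra.
Qed.

End Dyadic.

Section Squeeze.
Variable R : realType.

Definition squeeze (y : R) : R := (1 + contract y%:E) / 2.

Lemma squeeze_lt x y : (squeeze x < squeeze y) = (x < y).
Proof. by rewrite /squeeze ltr_pM2r ?invr_gt0 // ltrD2l lt_contract lte_fin. Qed.

Lemma squeeze_itv y : 0 < squeeze y < 1.
Proof. by have := contract_lt1 y; rewrite ltr_norml /squeeze; lra. Qed.

Lemma squeeze_surj t : 0 < t < 1 -> exists y, squeeze y = t.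
Proof.
move=> t01; pose s := 2 * t - 1.
have s1 : `|s| < 1 by rewrite ltr_norml /s; lra.
have := expandK (ltW s1 : s \in [pred r | `|r| <= 1]).
case e : (expand s) => [y||].
- by move=> cs; exists y; rewrite /squeeze cs /s; lra.
- have : 1 <= s by rewrite -expand_eqoo e.
  by move=> s1' _; exfalso; rewrite ltr_norml in s1; lra.
- have : s <= -1 by rewrite -expand_eqNoo e.
  by move=> s1' _; exfalso; rewrite ltr_norml in s1; lra.
Qed.

End Squeeze.

Section Uncountable.
Variables (R : realType) (d : Order.disp_t) (W : orderType d).
Hypothesis woW : well_ordered W.
Hypothesis initW : forall x : W, countable [set y : W | (y < x)%O].
Hypothesis hBA : baumgartner_axiom R.

Lemma countable_separating (Y : set R) x0 : Y x0 ->
  (forall x y, Y x -> x < y -> Y `&` [set z | x < z < y] !=set0) ->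
  exists e : nat -> R, (forall n, Y (e n)) /\
    forall x y, Y x -> x < y -> exists n, x < e n < y.
Proof.
move=> Yx0 dY.
pose pt (pq : rat * rat) := xget x0 (Y `&` [set z | ratr pq.1 < z < ratr pq.2]).
pose e n := if @unpickle (rat * rat)%type n is Some pq then pt pq else x0.
exists e; split=> [n|x y Yx xy].
  rewrite /e; case: unpickle => // pq; rewrite /pt.
  by case: xgetP => // z _ [].
have [z [Yz /andP[xz zy]]] := dY x y Yx xy.
have [p /andP[xp pz]] := rat_between xz; have [q /andP[zq qy]] := rat_between zy.
exists (pickle (p, q)); rewrite /e pickleK /pt.
have [_ /= /andP[pt1 pt2]] := @xgetI _ x0 (Y `&` [set z | ratr p < z < ratr q]) z
  (conj Yz (introT andP (conj pz zq))).
by rewrite (lt_trans xp pt1) (lt_trans pt2 qy).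
Qed.

(** [collapse] has values in [0, 1]; composing with the inverse of [squeeze]
    spreads the image over the whole line. *)
Lemma uncountable_collapse (X : set R) : ~ countable X ->
  exists (Z : set R) (F : R -> R), [/\ Z `<=` X,
    forall x y, Z x -> Z y -> x < y -> F x < F y &
    forall p q, p < q -> ~ countable (Z `&` [set z | p < F z < q])].
Proof.
move=> uX; have [Y [YX uY Yc]] := right_condensation uX.
have [x0 Yx0] := uncountable_ex uY.
have [x1 [Yx1 x01]] : exists x1, Y x1 /\ x0 < x1.
  have x0p : x0 < x0 + 1 by rewrite ltrDl.
  by have [z [Yz /= /andP[xz _]]] := uncountable_ex (Yc _ _ Yx0 x0p); exists z.
have [e [Ye esep]] : exists e : nat -> R, (forall n, Y (e n)) /\
    forall x y, Y x -> x < y -> exists n, x < e n < y.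
  apply: (countable_separating Yx0) => x y Yx xy.
  by have [z] := uncountable_ex (Yc _ _ Yx xy); exists z.
pose C := collapse e x0 x1.
pose Z := [set x | [/\ Y x, x0 <= x, x <= x1 & 0 < C x < 1]].
have /choice[F FP] x : exists y, Z x -> squeeze y = C x.
  have [Zx|nZ] := pselect (Z x); last by exists 0.
  by case: (Zx) => _ _ _ /squeeze_surj[y yE]; exists y.
exists Z, F; split.
- by move=> x [/YX].
- move=> x y Zx Zy xy; rewrite -squeeze_lt !FP //.
  case: Zx => Yx xx0 _ _; case: Zy => _ _ y1 _.
  exact: (collapse_lt Ye esep).
- move=> p q pq cZ.
  have /andP[p0 p1] := squeeze_itv p; have /andP[q0 q1] := squeeze_itv q.
  have [|a [b [Ya ab ax0 bx1 abC]]] :=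
    collapse_dense Ye esep Yx0 Yx1 x01 (ltW p0) _ (ltW q1).
    by rewrite squeeze_lt.
  apply: (Yc _ _ Ya ab); apply: countableS cZ => x [Yx /= /[dup] axb /andP[ax xb]].
  have /andP[pC Cq] := abC _ axb.
  have Zx : Z x.
    split=> //; [exact: ltW (le_lt_trans ax0 ax)|exact: ltW (lt_le_trans xb bx1)|].
    by rewrite (lt_trans p0 pC) (lt_trans Cq q1).
  by split=> //=; rewrite -(squeeze_lt p) -(squeeze_lt _ q) FP // pC.
Qed.

(** A subset of [X] maps injectively and monotonically onto an aleph_1-dense
    set, to which [A] is isomorphic. *)
Lemma embeds_uncountable A X : small_dense W A -> small W X -> ~ countable X ->
  exists g : R -> R, (forall a, A a -> X (g a)) /\
    (forall a b, A a -> A b -> a < b -> g a < g b).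
Proof.
move=> dA sX uX; have [Z [F [ZX Fm Fd]]] := uncountable_collapse uX.
have [w0 _] : exists w : W, True.
  by have [x Xx] := uncountable_ex uX; case: sX => f _; exists (f x).
have dB : small_dense W (F @` Z).
  split; first by apply: small_image => //; apply: small_sub ZX sX.
  move=> p q pq cB; apply: (Fd p q pq).
  apply: (countable_inj (f := F) _ _ cB) => [x [Zx /= pFq]|x y].
    by split=> //; exists x.
  rewrite !inE => -[Zx _] [Zy _] Fxy.
  case: (ltgtP x y) => // xy; [have := Fm _ _ Zx Zy xy|have := Fm _ _ Zy Zx xy].
    by rewrite Fxy ltxx.
  by rewrite Fxy ltxx.
have [f [fB _ _] fm] := hBA (small_dense_aleph1_dense woW initW dA)
                            (small_dense_aleph1_dense woW initW dB).
have /choice[g gP] a : exists x, A a -> Z x /\ F x = f a.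
  have [Aa|nA] := pselect (A a); last by exists 0.
  by have [x Zx Fx] := fB a Aa; exists x.
exists g; split=> [a /gP[/ZX]//|a b Aa Ab ab].
have [Za Fa] := gP a Aa; have [Zb Fb] := gP b Ab.
have : f a < f b by rewrite (leW_mono_in fm) ?inE.
rewrite -Fa -Fb; case: (ltgtP (g a) (g b)) => // [ba|->]; last by rewrite ltxx.
by move=> /(lt_trans (Fm _ _ Zb Za ba)); rewrite ltxx.
Qed.

End Uncountable.

(** * Replacing countably many points by intervals *)

(** The sum over all reals [a] of a copy of the line if [a] is in [D], and of a
    point otherwise, embeds in the line for countable [D]: at each [a] in [D],
    with index [c a], room [2 ^- c a] is made by the function [total], which
    jumps by that amount at [a]. *)
Section BlowUp.
Variables (R : realType) (D : set R) (c : R -> nat).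
Hypothesis cinj : {in D &, injective c}.

Let jump i (a : R) : R :=
  if `[< exists2 x, D x & c x = i /\ x < a >] then 2 ^- i else 0.
Let psum n a := \sum_(i < n) jump i a.

Let jump_ge0 i a : 0 <= jump i a.
Proof. by rewrite /jump; case: ifP => // _; rewrite invr_ge0 exprn_ge0. Qed.

Let jump_le i a b : a <= b -> jump i a <= jump i b.
Proof.
move=> ab; rewrite /jump; case: asboolP => [[x Dx [cx xa]]|_].
  by rewrite (asboolT (ex_intro2 _ _ x Dx (conj cx (lt_le_trans xa ab)))).
exact: jump_ge0.
Qed.

Let psum_ub n a : psum n a <= 2.
Proof.
suff : psum n a <= 2 - 2 * 2 ^- n.
  have : (0 : R) <= 2 ^- n by rewrite invr_ge0 exprn_ge0.
  by move: (2 ^- n) => e; lra.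
elim: n => [|n IH]; first by rewrite /psum big_ord0 expr0 invr1; lra.
rewrite /psum big_ord_recr /=; rewrite -/(psum n a).
have : jump n a <= 2 ^- n.
  by rewrite /jump; case: ifP => // _; rewrite invr_ge0 exprn_ge0.
move: (jump n a) => j.
have -> : (2 : R) ^- n.+1 = 2 ^- n / 2 by rewrite exprS invfM mulrC.
by move: (2 ^- n) (psum n a) IH => e p; lra.
Qed.

Let psum_mono m n a : (m <= n)%N -> psum m a <= psum n a.
Proof.
move=> mn; rewrite /psum -(subnKC mn) big_split_ord /= lerDl.
by apply: sumr_ge0 => i _; apply: jump_ge0.
Qed.

Let total a := sup [set psum n a | n in setT].

Let psum_total n a : psum n a <= total a.
Proof.
apply: ub_le_sup; last by exists n.
by exists 2 => _ [m _ <-]; apply: psum_ub.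
Qed.

Let total_le a r : (forall n, psum n a <= r) -> total a <= r.
Proof.
move=> ar; apply: ge_sup; first by exists (psum 0 a), 0%N.
by move=> _ [n _ <-].
Qed.

Let total_mono a b : a <= b -> total a <= total b.
Proof.
move=> ab; apply: total_le => n; apply: le_trans (psum_total n b).
by apply: ler_sum => i _; apply: jump_le.
Qed.

Let total_jump a b : D a -> a < b -> total a + 2 ^- c a <= total b.
Proof.
move=> Da ab; rewrite -lerBrDr; apply: total_le => n; rewrite lerBrDr.
pose N := maxn n (c a).+1.
apply: le_trans (psum_total N b).
apply: le_trans (lerD (psum_mono a (leq_maxl n (c a).+1)) (lexx _)) _.
have cN : (c a < N)%N by apply: leq_maxr.
rewrite -/N /psum (bigD1 (Ordinal cN)) //= [X in _ <= X](bigD1 (Ordinal cN)) //=.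
have -> : jump (c a) a = 0.
  rewrite /jump; case: asboolP => // -[x Dx [cx xa]].
  by move: xa; rewrite (cinj _ _ cx) ?inE // ltxx.
have -> : jump (c a) b = 2 ^- c a.
  by rewrite /jump (asboolT (ex_intro2 _ _ a Da (conj erefl ab))).
rewrite add0r [X in X <= _]addrC lerD2l; apply: ler_sum => i _; apply: jump_le.
exact: ltW.
Qed.

Definition blow a b :=
  a + total a + (if `[< D a >] then 2 ^- c a * squeeze b else 0).

Lemma blow_lt a b a' b' : a < a' -> blow a b < blow a' b'.
Proof.
move=> aa'; rewrite /blow -!addrA ltr_leD //.
apply: (@le_trans _ _ (total a')); last first.
  rewrite lerDl; case: ifP => // _; rewrite mulr_ge0 ?invr_ge0 ?exprn_ge0 //.
  by have /andP[/ltW] := squeeze_itv b'.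
case: asboolP => [Da|_]; last by rewrite addr0 total_mono // ltW.
apply: le_trans (total_jump Da aa'); rewrite lerD2l ler_piMr //.
  by rewrite invr_ge0 exprn_ge0.
by have /andP[_ /ltW] := squeeze_itv b.
Qed.

Lemma blow_lt_fiber a b b' : D a -> b < b' -> blow a b < blow a b'.
Proof.
move=> Da bb'; rewrite /blow asboolT // ltrD2l ltr_pM2l ?squeeze_lt //.
by rewrite invr_gt0 exprn_gt0.
Qed.

End BlowUp.

(** * Lexicographic powers *)

Section Words.
Variable R : realType.

Fixpoint lexlt (s t : seq R) : bool :=
  match s, t with
  | x :: s', y :: t' => (x < y) || (x == y) && lexlt s' t'
  | _, _ => false
  end.

(** Shortlex. On words of equal length it is the lexicographic order. *)
Definition slt (s t : seq R) : bool :=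
  (size s < size t)%N || (size s == size t) && lexlt s t.

Lemma lexlt_irr s : lexlt s s = false.
Proof. by elim: s => //= x s ->; rewrite ltxx eqxx. Qed.

Lemma slt_irr s : slt s s = false.
Proof. by rewrite /slt ltnn eqxx lexlt_irr. Qed.

Lemma lexlt_trans : transitive lexlt.
Proof.
elim=> [|y t IH] [|x s] [|z u] //= /orP[xy|/andP[/eqP-> st]] /orP[yz|/andP[/eqP<- tu]].
- by rewrite (lt_trans xy yz).
- by rewrite xy.
- by rewrite yz.
- by rewrite eqxx (IH _ _ st tu) orbT.
Qed.

Lemma slt_trans : transitive slt.
Proof.
move=> t s u; rewrite /slt => /orP[st|/andP[/eqP-> st]] /orP[tu|/andP[/eqP<- tu]].
- by rewrite (ltn_trans st tu).
- by rewrite st.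
- by rewrite tu.
- by rewrite eqxx (lexlt_trans st tu) orbT.
Qed.

Lemma slt_size s t : slt s t -> (size s <= size t)%N.
Proof. by case/orP => [/ltnW//|/andP[/eqP->]]. Qed.

Lemma slt_total s t : s != t -> slt s t || slt t s.
Proof.
move=> st; rewrite /slt [size t == _]eq_sym; case: ltngtP => //= e.
elim: s t e st => [|x s IH] [|y t] //= [/IH {}IH].
by rewrite eqseq_cons; case: (ltgtP x y) => //= _ /IH.
Qed.

Lemma slt_cat p s t : slt s t -> slt (p ++ s) (p ++ t).
Proof.
rewrite /slt !size_cat ltn_add2l eqn_add2l => /orP[->//|/andP[-> st]].
by apply/orP; right; elim: p => //= x p ->; rewrite eqxx orbT.
Qed.

Lemma slt_head_le x y s t : size s = size t -> slt (x :: s) (y :: t) -> x <= y.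
Proof.
by rewrite /slt /= => ->; rewrite ltnn eqxx /= => /orP[/ltW//|/andP[/eqP->]].
Qed.

Lemma slt_consE n x y s t : size s = n -> size t = n ->
  slt (x :: s) (y :: t) = (x < y) || (x == y) && slt s t.
Proof. by rewrite /slt /= => -> ->; rewrite !ltnn !eqxx. Qed.

Definition words (A : set R) n : set (seq R) :=
  [set s | size s = n /\ forall x, x \in s -> A x].

Lemma words_cons A n x s : words A n.+1 (x :: s) <-> A x /\ words A n s.
Proof.
split=> [[/= [sn] sA]|[Ax [sn sA]]].
  split; first by apply: sA; rewrite mem_head.
  by split=> // y ys; apply: sA; rewrite in_cons ys orbT.
split=> /= [|y]; first by rewrite sn.
by rewrite in_cons => /orP[/eqP->//|/sA].
Qed.

Lemma wordsS A n s : words A n.+1 s ->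
  exists x t, [/\ s = x :: t, A x & words A n t].
Proof.
by case: s => [[]//|x t /words_cons[Ax At]]; exists x, t.
Qed.

Definition emb (X Y : set (seq R)) := exists g : seq R -> seq R,
  (forall s, X s -> Y (g s)) /\
  (forall s t, X s -> X t -> slt s t -> slt (g s) (g t)).

Lemma emb_trans Y X Z : emb X Y -> emb Y Z -> emb X Z.
Proof.
move=> [f [fY fm]] [g [gZ gm]]; exists (g \o f).
split=> [s /fY/gZ//|s t Xs Xt st].
by apply: gm; [apply: fY|apply: fY|apply: fm].
Qed.

Definition fiber (X : set (seq R)) a := [set s | X (a :: s)].

Lemma emb_fiber X a : emb (fiber X a) X.
Proof. by exists (cons a); split=> // s t _ _; apply: (@slt_cat [:: a]). Qed.

Lemma words_nseq A n a : A a -> words A n (nseq n a).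
Proof. by move=> Aa; split=> [|x]; rewrite ?size_nseq // mem_nseq => /andP[_ /eqP->]. Qed.

Lemma words_cat A m n s t : words A m s -> words A n t -> words A (m + n) (s ++ t).
Proof.
move=> [sm sA] [tn tA]; split; first by rewrite size_cat sm tn.
by move=> x; rewrite mem_cat => /orP[/sA|/tA].
Qed.

Lemma words_emb_le A a m n : A a -> (m <= n)%N -> emb (words A m) (words A n).
Proof.
move=> Aa mn; exists (cat (nseq (n - m) a)); split=> [s sm|s t _ _].
  by rewrite -(subnK mn); apply: words_cat => //; rewrite addnK; apply: words_nseq.
exact: slt_cat.
Qed.

(** If [phi] were nonconstant on the words starting with [a] for every [a], the
    open intervals spanned by its values there would be nonempty and pairwise
    disjoint, so choosing a rational in each would inject [A] into the
    rationals. *)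
Lemma constant_fiber A n (phi : seq R -> R) : ~ countable A ->
  (forall s t, words A n.+1 s -> words A n.+1 t -> slt s t -> phi s <= phi t) ->
  exists2 a, A a & forall s t, words A n s -> words A n t ->
    phi (a :: s) = phi (a :: t).
Proof.
move=> uA phim; apply: contrapT => none; apply: uA.
have /choice[q qP] a : exists q : rat, A a -> exists s t,
    [/\ words A n s, words A n t, phi (a :: s) < ratr q & ratr q < phi (a :: t)].
  have [Aa|nA] := pselect (A a); last by exists 0.
  apply: contrapT => noq; apply: none; exists a => //.
  suff le s t : words A n s -> words A n t -> phi (a :: s) <= phi (a :: t).
    by move=> s t As At; apply/le_anti; rewrite !le.
  move=> As At; rewrite leNgt; apply/negP => /rat_between[q /andP[tq qs]].
  by apply: noq; exists q => _; exists t, s.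
have qlt a b : A a -> A b -> a < b -> q a < q b.
  move=> Aa Ab ab.
  have [_ [t [_ At _ qt]]] := qP a Aa; have [s [_ [As _ sq _]]] := qP b Ab.
  rewrite -(ltr_rat R) (lt_trans qt) // (le_lt_trans _ sq) //.
  apply: phim; try exact/words_cons.
  by rewrite (slt_consE _ _ (proj1 At) (proj1 As)) ab.
apply: (@countable_inj _ _ q A setT) => // a b; rewrite !inE => Aa Ab qab.
case: (ltgtP a b) => // ab; [have := qlt _ _ Aa Ab ab|have := qlt _ _ Ab Aa ab].
  by rewrite qab ltxx.
by rewrite qab ltxx.
Qed.

(** [constant_fiber] applied to the first letter of the image yields a letter
    [a] such that the words starting with [a] are mapped to words with a common
    first letter; deleting both first letters lowers [n] by one. *)
Lemma words_not_emb A n : ~ countable A -> ~ emb (words A n.+1) (words A n).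
Proof.
move=> uA; elim: n => [|n IH] [g [gA gm]].
  have [a Aa] := uncountable_ex uA.
  have [b [Ab ba]] : exists b, A b /\ b != a.
    apply: contrapT => nb; apply: uA; apply: countableS (countable1 a) => b Ab.
    by apply: contrapT => /eqP ba; apply: nb; exists b.
  have wa c : A c -> words A 1 [:: c] by move=> Ac; apply/words_cons; split.
  have nil_w c : A c -> g [:: c] = [::].
    by move=> Ac; have [+ _] := gA _ (wa c Ac); case: (g _).
  have [] : slt [:: b] [:: a] \/ slt [:: a] [:: b].
    by apply/orP/slt_total; rewrite eqseq_cons eqxx andbT.
  - by move=> /(gm _ _ (wa _ Ab) (wa _ Aa)); rewrite !nil_w.
  - by move=> /(gm _ _ (wa _ Aa) (wa _ Ab)); rewrite !nil_w.
have [s t As At st|a Aa ac] := @constant_fiber A n.+1 (head 0 \o g) uA.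
  have /= := gm _ _ As At st.
  have [x [s' [-> _ [ss _]]]] := wordsS (gA _ As).
  have [y [t' [-> _ [ts _]]]] := wordsS (gA _ At).
  by apply: slt_head_le; rewrite ss ts.
apply: IH; exists (behead \o g \o cons a); split=> [s As|s t As At st] /=.
  have Aas : words A n.+2 (a :: s) by apply/words_cons.
  by have [x [s' [-> _]]] := wordsS (gA _ Aas).
have Aas : words A n.+2 (a :: s) by apply/words_cons.
have Aat : words A n.+2 (a :: t) by apply/words_cons.
have := gm _ _ Aas Aat (@slt_cat [:: a] _ _ st).
have /= := ac _ _ As At.
have [x [s' [-> _ [ss _]]]] := wordsS (gA _ Aas).
have [y [t' [-> _ [ts _]]]] := wordsS (gA _ Aat).
by move=> /= ->; rewrite (slt_consE _ _ ss ts) ltxx eqxx.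
Qed.

(** [constant_fiber] applied to the length of the image reduces to words of a
    single length, at the cost of one letter; hence the [m.+2]. *)
Lemma words_not_emb_bounded A m : ~ countable A ->
  ~ emb (words A m.+2) [set s | (forall x, x \in s -> A x) /\ (size s <= m)%N].
Proof.
move=> uA [g [gA gm]].
have [s t As At /(gm _ _ As At)/slt_size|a Aa ac] :=
  @constant_fiber A m.+1 (fun s => (size (g s))%:R) uA.
  by rewrite ler_nat.
have wm : words A m.+1 (nseq m.+1 a) by apply: words_nseq.
have [_ jm] := gA _ (proj2 (words_cons A m.+1 a _) (conj Aa wm)).
set j := size _ in jm.
apply: (@words_not_emb A j uA); apply: emb_trans (words_emb_le Aa _) _.
  by apply: leq_trans (_ : (m.+1 <= m.+1)%N); rewrite ?ltnS // jm.
exists (g \o cons a); split=> [s As /=|s t As At st /=].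
  have [gsA _] := gA _ (proj2 (words_cons A m.+1 a _) (conj Aa As)).
  by split=> //; apply/eqP; rewrite -(eqr_nat R); apply/eqP/ac.
apply: gm; [exact/words_cons|exact/words_cons|].
exact: (@slt_cat [:: a]).
Qed.

End Words.

(** * The dichotomy for suborders of powers *)

Section Dichotomy.
Variables (R : realType) (d : Order.disp_t) (W : orderType d).
Hypothesis woW : well_ordered W.
Hypothesis initW : forall x : W, countable [set y : W | (y < x)%O].
Hypothesis hBA : baumgartner_axiom R.
Variable A : set R.
Hypothesis dA : small_dense W A.

Lemma small_dense_uncountable : ~ countable A.
Proof.
case: dA => _ /(_ 0 1 ltr01) u cA; apply: u.
by apply: countableS cA => x [].
Qed.

(** Compose [blow] with an embedding in [A] of its values at points of [A],
    which form a set of size at most aleph_1. *)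
Lemma embeds_blow (D : set R) : D `<=` A -> countable D ->
  exists h : R -> R -> R, [/\ forall a b, A a -> A b -> A (h a b),
    forall a b a' b', A a -> A b -> A a' -> A b' -> a < a' -> h a b < h a' b' &
    forall a b b', D a -> A b -> A b' -> b < b' -> h a b < h a b'].
Proof.
move=> DA /countable_injP[c cinj]; pose J := blow D c.
have [w0 _] : exists w : W, True.
  have [x _] := uncountable_ex small_dense_uncountable.
  by case: dA => -[f _] _; exists (f x).
pose Z := (fun s => J (nth 0 s 0) (nth 0 s 1)) @`
  [set s : seq R | forall x, x \in s -> A x].
have sZ : small W Z by apply: (small_image w0); apply: (small_seq initW w0); case: dA.
have ZJ a b : A a -> A b -> Z (J a b).
  by move=> Aa Ab; exists [:: a; b] => // x /=; rewrite !inE => /orP[]/eqP->.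
have [g [gA gm]] := small_embeds woW initW hBA dA sZ.
exists (fun a b => g (J a b)); split.
- by move=> a b Aa Ab; apply/gA/ZJ.
- move=> a b a' b' Aa Ab Aa' Ab' aa'.
  by apply: gm; [exact: ZJ|exact: ZJ|apply: blow_lt].
- move=> a b b' Da Ab Ab' bb'; have Aa := DA _ Da.
  by apply: gm; [exact: ZJ|exact: ZJ|apply: blow_lt_fiber].
Qed.

(** Induction on [k], then on [n].  Let [D] be the set of first letters [a] with
    [A^k] embedding in the fiber over [a].  If [D] were uncountable, [A] would embed in [D] and
    [A^(k+1)] in [X].  So [D] is countable.  Fibers outside [D] embed in [A^k]
    by the induction on [k], and fibers over [D] embed in [A^(k+1)] by the
    induction on [n].  The extra coordinate over [D] is absorbed by replacing
    the points of [D] in [A] by copies of [A], which [embeds_blow] permits. *)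
Lemma words_dichotomy k n (X : set (seq R)) : X `<=` words A n ->
  ~ emb (words A k) X -> emb X (words A k).
Proof.
elim: k n X => [|k IHk] n X Xn nX.
  exists id; split=> // s Xs; exfalso; apply: nX.
  exists (fun=> s); split=> // t u [/size0nil-> _] [/size0nil-> _].
  by rewrite slt_irr.
have [a0 Aa0] := uncountable_ex small_dense_uncountable.
elim: n X Xn nX => [|n IHn] X Xn nX.
  exists (fun=> nseq k.+1 a0); split=> [s _|s t /Xn[/size0nil-> _] /Xn[/size0nil-> _]].
    exact: words_nseq.
  by rewrite slt_irr.
have fn a : fiber X a `<=` words A n by move=> s /Xn/words_cons[].
have nfib a : ~ emb (words A k.+1) (fiber X a).
  by move=> /emb_trans/(_ (@emb_fiber _ X a)).
have /choice[e1 e1P] a := IHn _ (fn a) (nfib a).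
pose D := [set a | A a /\ emb (words A k) (fiber X a)].
have cD : countable D.
  apply: contrapT => uD; apply: nX.
  have sD : small W D by apply: small_sub (proj1 dA) => x [].
  have [h [hD hm]] := embeds_uncountable woW initW hBA dA sD uD.
  have /choice[e eP] a : exists e : seq R -> seq R, D a ->
      (forall s, words A k s -> fiber X a (e s)) /\
      (forall s t, words A k s -> words A k t -> slt s t -> slt (e s) (e t)).
    by have [[_ [e eP]]|nD] := pselect (D a); [exists e|exists id].
  exists (fun s => h (head 0 s) :: e (h (head 0 s)) (behead s)).
  split=> [s /wordsS[a [t [-> Aa At]]]|s t] /=.
    by have [+ _] := eP _ (hD a Aa); apply.
  move=> /wordsS[a [s' [-> Aa As]]] /wordsS[b [t' [-> Ab Bt]]] /=.
  have [ea _] := eP _ (hD _ Aa); have [eb _] := eP _ (hD _ Ab).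
  rewrite (slt_consE _ _ (proj1 As) (proj1 Bt)).
  rewrite (slt_consE _ _ (proj1 (fn _ _ (ea _ As))) (proj1 (fn _ _ (eb _ Bt)))).
  move=> /orP[/(hm _ _ Aa Ab)->//|/andP[/eqP ab st]]; subst b.
  by rewrite eqxx (proj2 (eP _ (hD _ Aa)) _ _ As Bt st) orbT.
have /choice[e2 e2P] a : exists e : seq R -> seq R, A a /\ ~ D a ->
    (forall s, fiber X a s -> words A k (e s)) /\
    (forall s t, fiber X a s -> fiber X a t -> slt s t -> slt (e s) (e t)).
  have [[Aa nD]|nA] := pselect (A a /\ ~ D a); last by exists id.
  have [|e eP] := IHk _ _ (fn a); last by exists e.
  by move=> ?; apply: nD.
have [h [hA hlt hfib]] := @embeds_blow D (fun a => @proj1 _ _) cD.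
(* Over D the first letter of e1 a s is merged with a; outside D the second
   argument of h is an arbitrary element of A, here a. *)
pose m a s := if `[< D a >] then h a (head 0 (e1 a s)) :: behead (e1 a s)
              else h a a :: e2 a s.
have mP a s : X (a :: s) -> exists b t, [/\ m a s = h a b :: t, A b & words A k t].
  move=> Xas; have /words_cons[Aa _] := Xn _ Xas.
  rewrite /m; case: asboolP => Da.
    have [/(_ _ Xas) + _] := e1P a => /wordsS[b [t [-> Ab At]]].
    by exists b, t.
  by exists a, (e2 a s); split=> //; apply: (proj1 (e2P a _)).
exists (fun s => m (head 0 s) (behead s)); split.
  move=> s Xs; have [a [s' [sE Aa As]]] := wordsS (Xn _ Xs).
  rewrite sE /= in Xs *; have [b [t [-> Ab At]]] := mP _ _ Xs.
  by apply/words_cons; split=> //; apply: hA.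
move=> s t Xs Xt; have [a [s' [sE Aa As]]] := wordsS (Xn _ Xs).
have [b [t' [tE Ab Bt]]] := wordsS (Xn _ Xt); subst s t => /=.
rewrite (slt_consE _ _ (proj1 As) (proj1 Bt)) => /orP[ab|/andP[/eqP ab st]].
  have [x [s [-> Ax [ss _]]]] := mP _ _ Xs; have [y [t [-> Ay [ts _]]]] := mP _ _ Xt.
  by rewrite (slt_consE _ _ ss ts) hlt.
subst b; rewrite /m; case: asboolP => Da.
  have [e1A e1m] := e1P a; have := e1m _ _ Xs Xt st.
  have [x [u [-> Ax [us _]]]] := wordsS (e1A _ Xs).
  have [y [v [-> Ay [vs _]]]] := wordsS (e1A _ Xt).
  rewrite /= !(slt_consE _ _ us vs) => /orP[xy|/andP[/eqP-> ->]].
    by rewrite hfib.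
  by rewrite eqxx orbT.
have [e2A e2m] := e2P a (conj Aa Da).
by apply: (@slt_cat _ [:: h a a]); apply: e2m.
Qed.

End Dichotomy.

(** * The sum of all finite powers *)

Section ShortLex.
Variable R : realType.

Definition sle (s t : seq R) := (s == t) || slt s t.

Lemma sle_anti : antisymmetric sle.
Proof.
move=> s t /andP[/orP[/eqP//|st] /orP[/eqP//|ts]].
by have := slt_trans st ts; rewrite slt_irr.
Qed.

Lemma sle_trans : transitive sle.
Proof.
move=> t s u /orP[/eqP->//|st] /orP[/eqP<-|tu]; rewrite /sle ?st ?orbT //.
by rewrite (slt_trans st tu) orbT.
Qed.

Lemma sle_total : total sle.
Proof.
move=> s t; rewrite /sle; case: (eqVneq s t) => //= /slt_total /orP[->//|->].
by rewrite !orbT.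
Qed.

Definition shortlex : orderType _ := rel_order sle_anti sle_trans sle_total.

Lemma shortlex_ltE (s t : shortlex) : (s < t)%O = slt s t.
Proof.
rewrite lt_neqAle; apply/andP/idP => [[/negPf st /orP[]]|st].
- by rewrite st.
- by [].
- split; last by apply/orP; right.
  by apply/eqP => e; move: st; rewrite e slt_irr.
Qed.

Definition word_order (A : set R) : orderType _ :=
  sub_type {s : shortlex | `[< forall x, x \in (s : seq R) -> A x >]}.

End ShortLex.

Lemma small_inj d (W : orderType d) T U (h : T -> U) (X : set T) (Y : set U) :
  injective h -> (forall x, X x -> Y (h x)) -> small W Y -> small W X.
Proof.
move=> hinj hXY [f fc]; exists (f \o h) => w.
apply: (countable_inj (f := h) _ _ (fc w)) => [x [/hXY Yx <-] //|x y _ _].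
exact: hinj.
Qed.

Lemma osum_inl_lt d1 d2 (P : orderType d1) (Q : orderType d2) (p p' : P) :
  ((inl p : osum P Q) < inl p')%O = (p < p')%O.
Proof. by rewrite !ltNge. Qed.

Lemma osum_inr_lt d1 d2 (P : orderType d1) (Q : orderType d2) (q q' : Q) :
  ((inr q : osum P Q) < inr q')%O = (q < q')%O.
Proof. by rewrite !ltNge. Qed.

Section WordOrder.
Variables (R : realType) (d : Order.disp_t) (W : orderType d).
Hypothesis woW : well_ordered W.
Hypothesis initW : forall x : W, countable [set y : W | (y < x)%O].
Hypothesis hBA : baumgartner_axiom R.
Variable A : set R.
Hypothesis dA : small_dense W A.

Local Notation T := (word_order A).
Local Notation over s := (forall x, x \in s -> A x).

Definition letters (t : T) : seq R := val t.

Definition word (s : seq R) : T :=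
  insubd (exist _ ([::] : shortlex R) (asboolT (fun x (h : x \in [::]) =>
    match notF h with end)) : T) (s : shortlex R).

Lemma wordK s : over s -> letters (word s) = s.
Proof. by move=> sA; rewrite /letters /word insubdK //; apply/asboolP. Qed.

Lemma letters_over t : over (letters t).
Proof. by have /asboolP := valP t. Qed.

Lemma letters_inj : injective letters.
Proof. exact: val_inj. Qed.

Lemma word_ltE (t u : T) : (t < u)%O = slt (letters t) (letters u).
Proof. by rewrite -shortlex_ltE. Qed.

Lemma letters_words t : words A (size (letters t)) (letters t).
Proof. by split; last exact: letters_over. Qed.

Let uA := small_dense_uncountable dA.

Lemma word_order_card : card_aleph1 [set: T].
Proof.
have [w0 _] : exists w : W, True.
  by have [x _] := uncountable_ex uA; case: dA => -[f _] _; exists (f x).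
apply: (small_card_aleph1 woW initW).
  apply: (small_inj letters_inj (Y := [set s : seq R | over s])).
    by move=> t _; apply: letters_over.
  by apply: (small_seq initW w0); case: dA.
move=> cT; apply: uA; apply: (countable_inj (f := fun x => word [:: x]) _ _ cT) => //.
have one x : A x -> over [:: x] by move=> Ax y; rewrite inE => /eqP->.
move=> x y; rewrite !inE => Ax Ay /(congr1 letters).
by rewrite !wordK; [case|apply: one|apply: one].
Qed.

Lemma word_order_not_well_ordered : ~ well_ordered T.
Proof.
move=> wo; have [x0 Ax0] := uncountable_ex uA.
have one x : A x -> over [:: x] by move=> Ax y; rewrite inE => /eqP->.
have [|t tX tmin] := @well_ordered_min _ T
    (fun t => exists2 x, A x & letters t = [:: x]) wo.
  by exists (word [:: x0]); exists x0 => //; apply/wordK/one.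
case: tX => x Ax tx.
have [y [Ay /= /andP[_ yx]]] : exists y, (A `&` [set y | x - 1 < y < x]) y.
  by apply: uncountable_ex; apply: (proj2 dA); rewrite ltrBlDr ltrDl.
have /tmin : exists2 x, A x & letters (word [:: y]) = [:: x].
  by exists y => //; apply/wordK/one.
rewrite leNgt word_ltE tx wordK; last exact: one.
by rewrite (slt_consE _ _ erefl erefl) yx.
Qed.

(** Words that precede a given word [w] have length at most that of [w], whereas
    prefixing more than [size w] letters moves every word above [w]. *)
Lemma word_order_indecomposable : strictly_indecomposable_right T.
Proof.
move=> dP dQ P Q [f [g fK gK] fmono] [q].
have flt := leW_mono fmono.
have glt u v : (u < v)%O -> (g u < g v)%O by move=> uv; rewrite -flt !gK.
have [a Aa] := uncountable_ex uA.
pose m := size (letters (g (inr q))).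
split.
  split; first by exists (fun p => g (inl p)) => p p' pp'; rewrite glt // osum_inl_lt.
  move=> [h hm]; apply: (@words_not_emb_bounded _ A m uA).
  exists (fun s => letters (g (inl (h (word s))))).
  split=> [s _|s t [_ sA] [_ tA] st].
    split; first exact: letters_over.
    by apply: slt_size; rewrite -word_ltE; apply: glt; rewrite ltNge.
  by rewrite -word_ltE; apply/glt; rewrite osum_inl_lt hm // word_ltE !wordK.
have pA t : over (nseq m.+1 a ++ letters t).
  move=> x; rewrite mem_cat mem_nseq => /orP[/andP[_ /eqP->//]|].
  exact: letters_over.
have fq t : exists q', f (word (nseq m.+1 a ++ letters t)) = inr q'.
  have : ((inr q : osum P Q) < f (word (nseq m.+1 a ++ letters t)))%O.
    rewrite -[X in (X < _)%O]gK flt word_ltE (wordK (@pA t)); apply/orP; left.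
    by rewrite size_cat size_nseq -/m addSn ltnS leq_addr.
  by case: (f _) => [p|q' _]; [rewrite ltNge|exists q'].
have /choice[h hP] := fq; exists h => t u tu.
rewrite -(osum_inr_lt P) -!hP flt word_ltE !(wordK (@pA _)).
by apply: slt_cat; rewrite -word_ltE.
Qed.

(** Either every power [A^k] embeds in arbitrarily long levels of [S], or from
    some length on all levels embed in one power. *)
Lemma word_order_succ (d' : Order.disp_t) (S : orderType d') :
  strictly_embeds S T -> embeds (osum S 'I_1) T.
Proof.
move=> [[f fm] nTS].
pose X n := [set letters (f s) | s in [set s | size (letters (f s)) = n]].
have Xn n : X n `<=` words A n by move=> _ [s /= <- <-]; apply: letters_words.
have fX s : X (size (letters (f s))) (letters (f s)) by exists s.
have flt (s t : S) : slt (letters (f s)) (letters (f t)) -> (s < t)%O.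
  rewrite -word_ltE !ltNge; apply: contra; exact: (ltW_homo fm).
have [[k [m km]]|rich] := pselect
  (exists k m, forall n, (m <= n)%N -> ~ emb (words A k) (X n)).
  have [a Aa] := uncountable_ex uA.
  have [w0 _] : exists w : W, True.
    by case: dA => -[g _] _; exists (g a).
  have [al [alA alm]] : exists al : nat -> R, (forall n, A (al n)) /\
      forall i j, (i < j)%N -> al i < al j.
    have sN : small W ((fun n : nat => n%:R : R) @` setT).
      by apply: (countable_small w0); apply: countable_image.
    have [g [gA gm]] := small_embeds woW initW hBA dA sN.
    exists (fun n => g n%:R); split=> [n|i j ij]; first by apply: gA; exists n.
    by apply: gm; [exists i|exists j|rewrite ltr_nat].
  have /choice[e eP] n : exists e : seq R -> seq R, (m <= n)%N ->
      (forall s, X n s -> words A k (e s)) /\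
      (forall s t, X n s -> X n t -> slt s t -> slt (e s) (e t)).
    have [mn|nm] := leqP m n; last by exists id.
    have [e eP] := words_dichotomy woW initW hBA dA (@Xn n) (km n mn).
    by exists e.
  (* Short words stay; a word of length n >= m goes to A^(k+1), placed over the
     n-th letter al n and padded to exceed the short words in length. *)
  pose b (v : seq R) := if (size v < m)%N then v
    else nseq m a ++ al (size v) :: e (size v) v.
  have bP s : over (b (letters (f s))) /\ (size (b (letters (f s))) <= m + k.+1)%N.
    rewrite /b; case: ltnP => [vm|mv].
      by split; [exact: letters_over|rewrite (leq_trans (ltnW vm)) // leq_addr].
    have [/(_ _ (fX s)) ev _] := eP _ mv.
    have [] : words A (m + k.+1) (nseq m a ++
        al (size (letters (f s))) :: e (size (letters (f s))) (letters (f s))).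
      by apply: words_cat; [apply: words_nseq|apply/words_cons].
    by move=> ->.
  exists (fun x => match x with inl s => word (b (letters (f s)))
                   | inr _ => word (nseq (m + k.+2) a) end).
  have topA : over (nseq (m + k.+2) a) by have [] := @words_nseq _ A (m + k.+2) a Aa.
  move=> [s|i] [t|j]; last first.
  - by rewrite !ltNge /Order.le /= !ord1.
  - by rewrite ltNge.
  - move=> _; rewrite word_ltE (wordK topA) (wordK (proj1 (bP s))); apply/orP; left.
    by rewrite size_nseq (leq_ltn_trans (proj2 (bP s))) // ltn_add2l.
  rewrite osum_inl_lt => /fm; rewrite !word_ltE.
  rewrite (wordK (proj1 (bP s))) (wordK (proj1 (bP t))).
  move=> st; have := slt_size st; rewrite /b => sz.
  case: ltnP => [sm|ms]; case: ltnP => [tm|mt] //.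
  - by apply/orP; left; rewrite size_cat size_nseq /= (leq_trans sm) // leq_addr.
  - by move: tm; rewrite ltnNge (leq_trans ms sz).
  - apply: slt_cat.
    have [/(_ _ (fX s))[es _] _] := eP _ ms; have [/(_ _ (fX t))[et _] _] := eP _ mt.
    rewrite (slt_consE _ _ es et).
    move: sz; rewrite leq_eqVlt => /orP[/eqP e_st|/alm->//].
    rewrite -e_st eqxx /=; apply/orP; right.
    have [_ em] := eP _ ms; apply: em => //; exact: fX || rewrite e_st; exact: fX.
exfalso; apply: nTS.
have /choice[c cP] (km : nat * nat) :
    exists n, (km.2 <= n)%N /\ emb (words A km.1) (X n).
  apply: contrapT => no; apply: rich; exists km.1, km.2 => n mn en.
  by apply: no; exists n.
(* Levels N 0 < N 1 < ... such that A^k embeds in the level N k. *)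
pose N := fix N k := if k is k'.+1 then c (k, (N k').+1) else c (0, 0)%N.
have Nlt i j : (i < j)%N -> (N i < N j)%N.
  elim: j => // j IH; have Nj : (N j < N j.+1)%N by have [] := cP (j.+1, (N j).+1).
  by rewrite ltnS leq_eqVlt => /orP[/eqP->//|/IH /ltn_trans]; apply.
have /choice[e eP] : forall k, emb (words A k) (X (N k)).
  case=> [|k]; first exact: (proj2 (cP (0, 0)%N)).
  exact: (proj2 (cP (k.+1, (N k).+1))).
have /choice[h hP] (t : T) : exists s, letters (f s) = e (size (letters t)) (letters t) /\
    size (letters (f s)) = N (size (letters t)).
  have [/(_ _ (letters_words t))[s sN sE] _] := eP (size (letters t)).
  by exists s.
exists h => t u; rewrite word_ltE => tu; apply: flt.
have [ht hts] := hP t; have [hu hus] := hP u.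
have := tu; rewrite {1}/slt => /orP[tu'|/andP[/eqP tu' _]].
  by apply/orP; left; rewrite hts hus Nlt.
rewrite ht hu -tu'; have [_ em] := eP (size (letters t)).
by apply: em => //; [apply: letters_words|rewrite tu'; apply: letters_words].
Qed.

End WordOrder.

Theorem theorem3p2 (R : realType) (hBA : baumgartner_axiom R) :
  exists (d : Order.disp_t) (T : orderType d),
    card_aleph1 [set: T] /\ hagendorf T.
Proof.
have [d [W [v [vinj woW initW uW]]]] := omega1_in_reals R.
have [A dA] := small_dense_exists vinj uW.
exists _, (word_order A); split; first exact: (word_order_card woW initW dA).
split.
- exact: (word_order_indecomposable dA).
- move=> d' S; exact: (word_order_succ woW initW hBA dA).
- exact: (word_order_not_well_ordered dA).
Qed.
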